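(* Let $a,b,\mu,\nu\geq 1$ be real numbers such that $b\geq \dfrac{3a+2}{a(a+1)}$. Then: (i) $\mathbb{W}_{(\mu,a),(\nu,b)}(z)$ is starlike in $\mathbb{D}$; (ii) $\mathbb{W}_{(\mu,a),(\nu,b)}(z)$ is close-to-convex with respect to the starlike function $\mathbb{W}_{(\mu,a),(1,b)}(z)$ in $\mathbb{D}$.
   Context: $\mathbb{D}=\{z\in\mathbb{C}:|z|<1\}$. The normalized four parameters Wright function is $$\mathbb{W}_{(\mu,a),(\nu,b)}(z)=\sum_{k=0}^{\infty}\frac{\Gamma(a)\Gamma(b)}{\Gamma(a+k\mu)\Gamma(b+k\nu)}\,z^{k+1};$$ $\mathbb{W}_{(\mu,a),(1,b)}$ is the same function with $\nu=1$. An analytic function $f$ on $\mathbb{D}$ with $f(0)=0$, $f'(0)=1$ is called starlike in $\mathbb{D}$ if $f$ is univalent in $\mathbb{D}$ and $f(\mathbb{D})$ is a star-shaped domain with respect to $0$; equivalently, $\Re\left(zf'(z)/f(z)\right)>0$ for all $z\in\mathbb{D}$. Such an $f$ is close-to-convex with respect to a starlike function $g$ in $\mathbb{D}$ if $\Re\left(zf'(z)/g(z)\right)>0$ for all $z\in\mathbb{D}$. *)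

(* Defs.v *)
From Stdlib Require Import Reals.
From Coquelicot Require Import Coquelicot.
Open Scope R_scope.

(* Euler's integral of the second kind, convergent for x > 0. *)
Definition Gamma (x : R) : R :=
  RInt_gen (fun t : R => Rpower t (x - 1) * exp (- t))
           (at_right 0) (Rbar_locally p_infty).

(* The topology of C is that of R * R, so a complex series is summed
   componentwise; like [Series], the value is arbitrary on divergent series. *)
Definition CSeries (u : nat -> C) : C :=
  (Series (fun k => Re (u k)), Series (fun k => Im (u k))).

Definition Wright (mu a nu b : R) (z : C) : C :=
  CSeries (fun k : nat =>
    (RtoC (Gamma a * Gamma b / (Gamma (a + INR k * mu) * Gamma (b + INR k * nu)))
     * z ^ (S k))%C).

Definition unit_disk (z : C) : Prop := Cmod z < 1.

Definition analytic_on (U : C -> Prop) (f : C -> C) : Prop :=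
  forall z : C, U z -> ex_derive (K := C_AbsRing) (V := C_NormedModule) f z.

Definition normalized_analytic (f : C -> C) : Prop :=
  analytic_on unit_disk f /\ f (RtoC 0) = RtoC 0 /\ C_derive f (RtoC 0) = RtoC 1.

Definition univalent_on (U : C -> Prop) (f : C -> C) : Prop :=
  analytic_on U f /\
  forall z1 z2 : C, U z1 -> U z2 -> f z1 = f z2 -> z1 = z2.

Definition image (f : C -> C) (U : C -> Prop) (w : C) : Prop :=
  exists z : C, U z /\ f z = w.

(* Connectedness of the domain is implied by the segment condition. *)
Definition star_shaped_domain_0 (S : C -> Prop) : Prop :=
  open S /\ S (RtoC 0) /\
  forall (w : C) (t : R), S w -> 0 <= t <= 1 -> S (RtoC t * w)%C.

Definition starlike (f : C -> C) : Prop :=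
  normalized_analytic f /\ univalent_on unit_disk f /\
  star_shaped_domain_0 (image f unit_disk).

(* At z = 0 the quotient z f'(z) / g(z) is 0/0; its removable singularity there
   has value f'(0) / g'(0) = 1, so only z <> 0 carries a condition.  The zeros of g
   need no separate exclusion: division by 0 in C yields 0. *)
Definition close_to_convex_wrt (f g : C -> C) : Prop :=
  normalized_analytic f /\ starlike g /\
  forall z : C, unit_disk z -> z <> RtoC 0 ->
    0 < Re (z * C_derive f z / g z)%C.

(* Main.v *)
Require Import Defs.
From Stdlib Require Import Reals Lra Lia Psatz.
From Coquelicot Require Import Coquelicot.
Open Scope R_scope.

(** Write [W(z) = z + h(z)], [h(z)] being the sum of the [a_k z^(k+2)].  Since [Gamma] is
    increasing on [2, oo[ (it is convex and [Gamma 1 = Gamma 2]), the coefficients are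
    largest at [mu = nu = 1], where they are explicit; the hypothesis on [b] then gives
    [q = sum (k+2) a_k < 1].  So [h] is a [q]-contraction of the closed disk: [W] is
    injective there, and, composing [h] with the metric projection [P] onto the closed disk,
    [z + h(P z) = w] has a solution for every [w], by Banach's fixed point theorem.  This
    gives that the image of the disk is open.  For [w = t W(z0)] with [0 <= t <= 1], the
    inequality [|1 - t u^n| <= n |1 - t u|] for [|u| <= 1] forces the solution into the open
    disk, so the image is star-shaped.  Close-to-convexity is [|z f' - g| < |g|], again from
    [q < 1] for [g]. *)

(** * The Gamma function on [1, oo[ *)

(** Reduces a limit statement about integrals over ]0, oo[ to explicit ranges: left endpoints close
    to 0 and right endpoints large. *)
Lemma filter_prod_improper (P : R -> R -> Prop) (u0 v0 : R) :
  0 < u0 ->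
  (forall u v, 0 < u < u0 -> v0 < v -> P u v) ->
  filter_prod (at_right 0) (Rbar_locally p_infty) (fun uv => P (fst uv) (snd uv)).
Proof.
  intros Hu0 HP.
  apply (Filter_prod _ _ _ (fun u => 0 < u < u0) (fun v => v0 < v)).
  - exists (mkposreal u0 Hu0); intros u Hu Hu'.
    apply Rabs_lt_between' in Hu; simpl in Hu; lra.
  - exists v0; auto.
  - intros u v; apply HP.
Qed.

Lemma filter_prod_le :
  filter_prod (at_right 0) (Rbar_locally p_infty) (fun uv : R * R => fst uv <= snd uv).
Proof.
  apply (filter_prod_improper (fun u v => u <= v) 1 1); intros; lra.
Qed.

Lemma ex_RInt_continuous_pos (f : R -> R) (u v : R) :
  0 < u -> 0 < v -> (forall t, 0 < t -> continuous f t) -> ex_RInt f u v.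
Proof.
  intros Hu Hv Hf; apply (ex_RInt_continuous f); intros t [Ht _].
  apply Hf; apply Rlt_le_trans with (2 := Ht); now apply Rmin_glb_lt.
Qed.

(** For a nonnegative [f] the integral over [u, v] grows with the interval, so it converges to its
    supremum [l]. The second conclusion later bounds [Gamma] from below by an integral over
    [1, 2]. *)
Lemma is_RInt_gen_nonneg_bounded (f : R -> R) (B : R) :
  (forall t, 0 < t -> continuous f t) ->
  (forall t, 0 < t -> 0 <= f t) ->
  (forall u v, 0 < u <= v -> RInt f u v <= B) ->
  exists l, is_RInt_gen f (at_right 0) (Rbar_locally p_infty) l /\
    (forall u v, 0 < u <= v -> RInt f u v <= l).
Proof.
  intros Hc Hp HB.
  set (E := fun y => exists u v, 0 < u <= v /\ y = RInt f u v).
  destruct (completeness E) as [l [Hub Hlub]].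
  - exists B; intros y (u & v & Huv & ->); now apply HB.
  - exists (RInt f 1 1), 1, 1; split; [lra | easy].
  - assert (Hl : forall u v, 0 < u <= v -> RInt f u v <= l)
      by (intros u v Huv; apply Hub; now exists u, v).
    exists l; split; [| exact Hl].
    apply filterlimi_locally; intros eps.
    assert (Hex : exists u v, 0 < u <= v /\ l - eps < RInt f u v).
    { destruct (Classical_Prop.classic (exists u v, 0 < u <= v /\ l - eps < RInt f u v))
        as [H | H]; [exact H | exfalso].
      assert (l <= l - eps); [| destruct eps; simpl in *; lra].
      apply Hlub; intros y (u & v & Huv & ->).
      apply Rnot_lt_le; intros Hlt; apply H; now exists u, v. }
    destruct Hex as (u0 & v0 & Huv0 & Hclose).
    apply (filter_prod_improper (fun u v => exists y, is_RInt f u v y /\ ball l eps y) u0 v0);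
      [lra |].
    intros u v Hu Hv; exists (RInt f u v); split.
    + apply (RInt_correct f), ex_RInt_continuous_pos; auto; lra.
    + assert (ex_RInt f u u0) by (apply ex_RInt_continuous_pos; auto; lra).
      assert (ex_RInt f u0 v0) by (apply ex_RInt_continuous_pos; auto; lra).
      assert (ex_RInt f v0 v) by (apply ex_RInt_continuous_pos; auto; lra).
      assert (ex_RInt f u v0) by (apply ex_RInt_continuous_pos; auto; lra).
      assert (RInt f u v = RInt f u u0 + RInt f u0 v0 + RInt f v0 v) as Hsplit.
      { rewrite <- (RInt_Chasles f u v0 v) by assumption.
        rewrite <- (RInt_Chasles f u u0 v0) by assumption; reflexivity. }
      assert (0 <= RInt f u u0)
        by (apply RInt_ge_0; [lra | assumption | intros; apply Hp; lra]).
      assert (0 <= RInt f v0 v)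
        by (apply RInt_ge_0; [lra | assumption | intros; apply Hp; lra]).
      assert (RInt f u v <= l) by (apply Hl; lra).
      apply Rabs_lt_between'; destruct eps; simpl in *; lra.
Qed.

(** The norm inequality for improper integrals, with [f] as its own bound, gives |l| <= l. *)
Lemma is_RInt_gen_ge_0 (f : R -> R) (l : R) :
  (forall t, 0 < t -> 0 <= f t) ->
  is_RInt_gen f (at_right 0) (Rbar_locally p_infty) l -> 0 <= l.
Proof.
  intros Hp Hl.
  apply Rle_trans with (1 := norm_ge_0 l).
  apply (RInt_gen_norm (Fa := at_right 0) (Fb := Rbar_locally p_infty) f f l l); auto.
  - apply filter_prod_le.
  - apply (filter_prod_improper
             (fun u v => forall t, u <= t <= v -> norm (f t) <= f t) 1 0); [lra |].
    intros u v Hu _ t Ht; right; apply Rabs_pos_eq, Hp; lra.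
Qed.

Lemma ln_le_tangent (s t : R) : 0 < s -> 0 < t -> ln t <= t / s - 1 + ln s.
Proof.
  intros Hs Ht.
  assert (Hd : 0 < t / s) by now apply Rdiv_lt_0_compat.
  assert (ln t = ln (t / s) + ln s) as ->.
  { rewrite <- ln_mult by assumption; f_equal; field; lra. }
  assert (1 + ln (t / s) <= exp (ln (t / s))) as H by apply exp_ineq1_le.
  rewrite exp_ln in H by assumption; lra.
Qed.

(** Multiplied by exp (- t), this bounds t^p exp (- t) by K exp (- t / 2), which is integrable and
    tends to 0 at infinity. The bound comes from the tangent to [ln] at [s]. *)
Lemma Rpower_le_exp_half (p : R) :
  0 <= p -> exists K, 0 < K /\ forall t, 0 < t -> Rpower t p <= K * exp (t / 2).
Proof.
  (* The slope p / s has to be at most 1/2; the added 1 keeps [s] positive when p = 0. *)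
  intros Hp; set (s := 2 * p + 1).
  exists (exp (p * (ln s - 1))); split; [apply exp_pos |].
  intros t Ht; unfold Rpower; rewrite <- exp_plus.
  assert (Hs : 0 < s) by (unfold s; lra).
  assert (p * ln t <= p * (t / s - 1 + ln s))
    by (apply Rmult_le_compat_l; [assumption | now apply ln_le_tangent]).
  assert (p * (t / s) <= t / 2).
  { replace (p * (t / s)) with (t * (p / s)) by (field; lra).
    apply Rmult_le_compat_l; [lra |].
    apply (Rmult_le_reg_r s); [assumption |]; unfold s in *; field_simplify; lra. }
  destruct (Req_dec (p * ln t) (p * (ln s - 1) + t / 2)) as [-> | Hne]; [lra |].
  left; apply exp_increasing; lra.
Qed.

Definition gamma_integrand (x t : R) : R := Rpower t (x - 1) * exp (- t).

Lemma gamma_integrand_pos (x t : R) : 0 < gamma_integrand x t.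
Proof. apply Rmult_lt_0_compat; apply exp_pos. Qed.

Lemma continuous_gamma_integrand (x t : R) : 0 < t -> continuous (gamma_integrand x) t.
Proof.
  intros Ht; apply (ex_derive_continuous (gamma_integrand x)).
  unfold gamma_integrand, Rpower; auto_derive; auto.
Qed.

Lemma is_RInt_gen_Gamma (x : R) : 1 <= x ->
  is_RInt_gen (gamma_integrand x) (at_right 0) (Rbar_locally p_infty) (Gamma x) /\
  0 < Gamma x.
Proof.
  intros Hx.
  destruct (Rpower_le_exp_half (x - 1)) as (K & HK & Hbound); [lra |].
  destruct (is_RInt_gen_nonneg_bounded (gamma_integrand x) (2 * K)) as (l & Hl & Hle).
  - apply continuous_gamma_integrand.
  - intros t _; left; apply gamma_integrand_pos.
  - intros u v Huv.
    (* The dominating function has the antiderivative - 2 K exp (- t / 2), so its integrals stay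
       below 2 K. *)
    assert (Hint : is_RInt (fun t => K * exp (- (t / 2))) u v
              (minus (- (2 * K) * exp (- (v / 2))) (- (2 * K) * exp (- (u / 2))))).
    { apply (is_RInt_derive (fun t => - (2 * K) * exp (- (t / 2)))).
      - intros t _; auto_derive; [easy | unfold Rdiv; field].
      - intros t _; apply (ex_derive_continuous (fun t => K * exp (- (t / 2)))).
        auto_derive; auto. }
    apply Rle_trans with (RInt (fun t => K * exp (- (t / 2))) u v).
    + apply RInt_le; [lra | | eexists; apply Hint |].
      * apply ex_RInt_continuous_pos; try lra; apply continuous_gamma_integrand.
      * intros t Ht; unfold gamma_integrand.
        replace (exp (- (t / 2))) with (exp (t / 2) * exp (- t))
          by (rewrite <- exp_plus; f_equal; lra).
        rewrite <- Rmult_assoc; apply Rmult_le_compat_r; [left; apply exp_pos |].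
        apply Hbound; lra.
    + rewrite (is_RInt_unique _ _ _ _ Hint); unfold minus, plus, opp; simpl.
      assert (0 < exp (- (v / 2))) by apply exp_pos.
      assert (exp (- (u / 2)) < 1) by (rewrite <- exp_0; apply exp_increasing; lra).
      nra.
  - assert (Gamma x = l) as ->.
    { apply (is_RInt_gen_unique (Fa := at_right 0) (Fb := Rbar_locally p_infty)
               (gamma_integrand x) l Hl). }
    split; [exact Hl |].
    apply Rlt_le_trans with (2 := Hle 1 2 ltac:(lra)).
    apply RInt_gt_0; [lra | intros; apply gamma_integrand_pos |].
    intros t Ht; apply continuous_gamma_integrand; lra.
Qed.

Lemma Gamma_pos (x : R) : 1 <= x -> 0 < Gamma x.
Proof. apply is_RInt_gen_Gamma. Qed.

(** The boundary term at 0 in the integration by parts of [Gamma_succ]; for 0 < t < 1 it is at most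
    t in modulus, because 1 <= x. *)
Lemma filterlim_Rpower_exp_0 (x : R) : 1 <= x ->
  filterlim (fun t => - (Rpower t x * exp (- t))) (at_right 0) (locally 0).
Proof.
  intros Hx; apply filterlim_locally; intros eps.
  assert (Hm : 0 < Rmin 1 eps) by (apply Rmin_pos; [lra | apply cond_pos]).
  exists (mkposreal _ Hm); intros t Ht Ht0.
  apply Rabs_lt_between' in Ht; simpl in Ht.
  assert (t < 1) by (assert (Rmin 1 eps <= 1) by apply Rmin_l; lra).
  assert (t < eps) by (assert (Rmin 1 eps <= eps) by apply Rmin_r; lra).
  assert (0 < exp (- t)) by apply exp_pos.
  assert (exp (- t) < 1) by (rewrite <- exp_0; apply exp_increasing; lra).
  assert (0 < Rpower t x) by apply exp_pos.
  assert (Rpower t x <= t).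
  { rewrite <- (Rpower_1 t) at 2 by assumption.
    unfold Rpower.
    assert (ln t < 0) by (rewrite <- ln_1; apply ln_increasing; lra).
    destruct (Req_dec x 1) as [-> | Hne]; [lra |].
    left; apply exp_increasing; nra. }
  apply Rabs_lt_between'; simpl; nra.
Qed.

Lemma filterlim_Rpower_exp_p_infty (x : R) : 0 <= x ->
  filterlim (fun t => - (Rpower t x * exp (- t))) (Rbar_locally p_infty) (locally 0).
Proof.
  intros Hx; apply filterlim_locally; intros eps.
  destruct (Rpower_le_exp_half x Hx) as (K & HK & Hbound).
  assert (He : 0 < 2 * K / eps) by (apply Rdiv_lt_0_compat; [lra | apply cond_pos]).
  (* Beyond this threshold exp (t / 2) >= 1 + t / 2 > K / eps. *)
  exists (2 * K / eps); intros t Ht.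
  assert (Ht0 : 0 < t) by lra.
  assert (0 < Rpower t x * exp (- t)) by (apply Rmult_lt_0_compat; apply exp_pos).
  assert (Rpower t x * exp (- t) <= K * exp (- (t / 2))).
  { replace (exp (- (t / 2))) with (exp (t / 2) * exp (- t))
      by (rewrite <- exp_plus; f_equal; lra).
    rewrite <- Rmult_assoc; apply Rmult_le_compat_r; [left; apply exp_pos | auto]. }
  assert (exp (- (t / 2)) < eps / K).
  { rewrite exp_Ropp.
    assert (1 + t / 2 <= exp (t / 2)) by apply exp_ineq1_le.
    replace (eps / K) with (/ (K / eps)) by (field; split; [| apply Rgt_not_eq, cond_pos]; lra).
    apply Rinv_lt_contravar.
    - apply Rmult_lt_0_compat; [| apply exp_pos].
      apply Rdiv_lt_0_compat; [assumption | apply cond_pos].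
    - replace (2 * K / eps) with (2 * (K / eps)) in Ht by (unfold Rdiv; ring); lra. }
  assert (K * exp (- (t / 2)) < eps).
  { replace (pos eps) with (K * (eps / K)) by (field; lra).
    now apply Rmult_lt_compat_l. }
  apply Rabs_lt_between'; simpl; lra.
Qed.

(** Integration by parts: [F] is an antiderivative of the difference of the two integrands and tends
    to 0 at both ends, so the difference integrates to 0. *)
Lemma Gamma_succ (x : R) : 1 <= x -> Gamma (x + 1) = x * Gamma x.
Proof.
  intros Hx.
  set (F := fun t => - (Rpower t x * exp (- t))).
  assert (HF : forall t, 0 < t ->
    is_derive F t (gamma_integrand (x + 1) t - x * gamma_integrand x t)).
  { intros t Ht; unfold F, gamma_integrand, Rpower; auto_derive; [auto |].
    replace ((x + 1 - 1) * ln t) with (x * ln t) by ring.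
    replace (exp (x * ln t)) with (t * exp ((x - 1) * ln t)).
    - field; lra.
    - rewrite <- (exp_ln t) at 1 by assumption; rewrite <- exp_plus; f_equal; ring. }
  assert (Hint : is_RInt_gen (fun t => gamma_integrand (x + 1) t - x * gamma_integrand x t)
            (at_right 0) (Rbar_locally p_infty) (0 - 0)).
  { assert (Hpos : forall u v t, 0 < u < 1 -> 1 < v ->
              Rmin u v <= t -> 0 < t).
    { intros u v t Hu Hv Ht; rewrite Rmin_left in Ht; lra. }
    apply (is_RInt_gen_ext (Derive F)).
    - apply (filter_prod_improper (fun u v => forall t, Rmin u v < t < Rmax u v -> _) 1 1);
        [lra |].
      intros u v Hu Hv t Ht; apply is_derive_unique, HF.
      apply (Hpos u v); try assumption; lra.
    - apply is_RInt_gen_Derive.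
      + apply (filter_prod_improper
                 (fun u v => forall t, Rmin u v <= t <= Rmax u v -> ex_derive F t) 1 1); [lra |].
        intros u v Hu Hv t Ht; eexists; apply HF, (Hpos u v); tauto.
      + apply (filter_prod_improper
                 (fun u v => forall t, Rmin u v <= t <= Rmax u v -> continuous (Derive F) t) 1 1);
          [lra |].
        intros u v Hu Hv t Ht.
        assert (Ht0 : 0 < t) by (apply (Hpos u v); tauto).
        apply (continuous_ext_loc (Derive F)
                 (fun t => gamma_integrand (x + 1) t - x * gamma_integrand x t)).
        (* The derivative of [F] is known only on ]0, oo[; the ball of radius t around t stays
           inside. *)
        * exists (mkposreal t Ht0); intros s Hs; symmetry; apply is_derive_unique, HF.
          apply Rabs_lt_between' in Hs; simpl in Hs; lra.
        * apply (continuous_minus (gamma_integrand (x + 1)) (fun t => x * gamma_integrand x t)).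
          -- now apply continuous_gamma_integrand.
          -- apply (continuous_scal_r x (gamma_integrand x)).
             now apply continuous_gamma_integrand.
      + now apply filterlim_Rpower_exp_0.
      + apply filterlim_Rpower_exp_p_infty; lra. }
  assert (H : is_RInt_gen (fun t => gamma_integrand (x + 1) t - x * gamma_integrand x t)
            (at_right 0) (Rbar_locally p_infty) (Gamma (x + 1) - x * Gamma x)).
  { apply (is_RInt_gen_minus (gamma_integrand (x + 1)) (fun t => x * gamma_integrand x t)).
    - apply is_RInt_gen_Gamma; lra.
    - apply (is_RInt_gen_scal (gamma_integrand x) x), is_RInt_gen_Gamma, Hx. }
  apply (is_RInt_gen_unique (V := R_CompleteNormedModule)) in Hint, H.
  rewrite H in Hint; lra.
Qed.

(* Convexity of [p => t^p]: the chord slope over [p, q], with [1 <= p], is at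
   least the slope [t - t^0] of the chord over [0, 1]. *)
Lemma Rpower_chord_slope (t p q : R) : 0 < t -> 1 <= p <= q ->
  (q - p) * (t - 1) <= Rpower t q - Rpower t p.
Proof.
  intros Ht Hpq.
  (* The chain is (q - p) (t - 1) <= (q - p) t L <= (q - p) t^p L <= t^q - t^p. In the middle, t^(p
     - 1) - 1 and L have the same sign or the former vanishes. *)
  set (L := ln t).
  assert (HL1 : t - 1 <= t * L).
  { assert (1 + - L <= exp (- L)) as H by apply exp_ineq1_le.
    rewrite exp_Ropp in H; unfold L in *; rewrite exp_ln in H by assumption.
    apply (Rmult_le_compat_l t) in H; [| lra].
    rewrite Rinv_r in H by lra; lra. }
  assert (HL2 : t * L <= Rpower t p * L).
  { assert (Rpower t p = t * exp ((p - 1) * L)) as ->.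
    { unfold Rpower; rewrite <- (exp_ln t) at 2 by assumption.
      rewrite <- exp_plus; f_equal; unfold L; ring. }
    assert (1 + (p - 1) * L <= exp ((p - 1) * L)) by apply exp_ineq1_le.
    assert (0 < exp ((p - 1) * L)) by apply exp_pos.
    destruct (Rle_dec 0 L) as [HL | HL].
    - assert (0 <= (p - 1) * L) by (apply Rmult_le_pos; lra).
      assert (0 <= (t * L) * (exp ((p - 1) * L) - 1))
        by (apply Rmult_le_pos; [apply Rmult_le_pos |]; lra).
      lra.
    - assert (exp ((p - 1) * L) <= 1).
      { apply Rle_trans with (exp 0); [| rewrite exp_0; lra].
        destruct (Req_dec p 1) as [-> | Hne].
        - right; f_equal; ring.
        - left; apply exp_increasing; nra. }
      assert (0 <= (t * - L) * (1 - exp ((p - 1) * L)))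
        by (apply Rmult_le_pos; [apply Rmult_le_pos |]; lra).
      lra. }
  assert (Rpower t q = Rpower t p * exp ((q - p) * L)) as ->.
  { unfold Rpower; rewrite <- exp_plus; f_equal; unfold L; ring. }
  assert (1 + (q - p) * L <= exp ((q - p) * L)) by apply exp_ineq1_le.
  assert (0 < Rpower t p) by apply exp_pos.
  assert (Rpower t p * ((q - p) * L) <= Rpower t p * (exp ((q - p) * L) - 1))
    by (apply Rmult_le_compat_l; lra).
  assert ((q - p) * (t - 1) <= (q - p) * (Rpower t p * L))
    by (apply Rmult_le_compat_l; lra).
  lra.
Qed.

(* Integrating [Rpower_chord_slope] against [exp (- t)] gives
   [Gamma y - Gamma x >= (y - x) (Gamma 2 - Gamma 1) = 0]. *)
Lemma Gamma_le (x y : R) : 2 <= x <= y -> Gamma x <= Gamma y.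
Proof.
  intros Hxy.
  assert (H21 : Gamma 2 = Gamma 1).
  { replace 2 with (1 + 1) by ring; rewrite Gamma_succ; lra. }
  assert (0 <= (Gamma y - Gamma x) - (y - x) * (Gamma 2 - Gamma 1)); [| rewrite H21 in *; lra].
  apply (is_RInt_gen_ge_0
    (fun t => (gamma_integrand y t - gamma_integrand x t)
              - (y - x) * (gamma_integrand 2 t - gamma_integrand 1 t))).
  - intros t Ht; unfold gamma_integrand.
    replace (2 - 1) with 1 by ring; rewrite Rpower_1 by assumption.
    replace (1 - 1) with 0 by ring; rewrite Rpower_O by assumption.
    (* The exponents are x - 1 and y - 1, whence the bound 2 <= x. *)
    assert (H := Rpower_chord_slope t (x - 1) (y - 1) Ht ltac:(lra)).
    assert (0 < exp (- t)) by apply exp_pos.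
    assert (0 <= (Rpower t (y - 1) - Rpower t (x - 1) - (y - x) * (t - 1)) * exp (- t))
      by (apply Rmult_le_pos; lra).
    lra.
  - apply (is_RInt_gen_minus (fun t => gamma_integrand y t - gamma_integrand x t)
             (fun t => (y - x) * (gamma_integrand 2 t - gamma_integrand 1 t))).
    + apply (is_RInt_gen_minus (gamma_integrand y) (gamma_integrand x));
        apply is_RInt_gen_Gamma; lra.
    + apply (is_RInt_gen_scal (fun t => gamma_integrand 2 t - gamma_integrand 1 t) (y - x)).
      apply (is_RInt_gen_minus (gamma_integrand 2) (gamma_integrand 1));
        apply is_RInt_gen_Gamma; lra.
Qed.

(** * Complex series, powers and contractions *)

Lemma Cmod_sqr (z : C) : Cmod z * Cmod z = Re z * Re z + Im z * Im z.
Proof. assert (H := Cmod2_alt z); simpl in H; lra. Qed.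

Lemma Cmod_le_of_sqr (z w : C) :
  Re z * Re z + Im z * Im z <= Re w * Re w + Im w * Im w -> Cmod z <= Cmod w.
Proof.
  rewrite <- !Cmod_sqr; intros H; apply Rnot_lt_le; intros Hlt.
  assert (0 <= Cmod w) by apply Cmod_ge_0.
  assert (Cmod w * Cmod w < Cmod z * Cmod z) by (apply Rmult_le_0_lt_compat; assumption).
  lra.
Qed.

Lemma Cmod_minus_comm (z w : C) : Cmod (z - w) = Cmod (w - z).
Proof. rewrite <- (Cmod_opp (z - w)); f_equal; ring. Qed.

Lemma Cmod_minus_le (z w : C) : Cmod z - Cmod w <= Cmod (z - w).
Proof.
  assert (H := Cmod_triangle (z - w) w).
  replace (z - w + w)%C with z in H by ring; lra.
Qed.

Lemma Re_le_Cmod (z : C) : Re z <= Cmod z.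
Proof. apply Rle_trans with (1 := Rle_abs _), re_le_Cmod. Qed.

Lemma Im_le_Cmod_abs (z : C) : Rabs (Im z) <= Cmod z.
Proof. apply Rle_trans with (2 := Rmax_Cmod z), Rmax_r. Qed.

Lemma Cmod_pow_le_1 (z : C) (n : nat) : Cmod z <= 1 -> Cmod (z ^ n) <= 1.
Proof.
  intros Hz; rewrite Cmod_pow, <- (pow1 n); apply pow_incr.
  split; [apply Cmod_ge_0 | assumption].
Qed.

(** The squared moduli differ by (r - s) (r + s - 2 Re x). *)
Lemma Cmod_real_minus_le (s r : R) (x : C) :
  Re x <= s <= r -> Cmod (RtoC s - x) <= Cmod (RtoC r - x).
Proof.
  intros H; apply Cmod_le_of_sqr; destruct x as [p q]; simpl in *.
  assert (0 <= (r - s) * (r + s - 2 * p)) by (apply Rmult_le_pos; lra).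
  lra.
Qed.

Lemma ex_series_Re (u : nat -> C) :
  ex_series (fun k => Cmod (u k)) -> ex_series (fun k => Re (u k)).
Proof. apply (ex_series_le (V := R_CompleteNormedModule)); intros n; apply re_le_Cmod. Qed.

Lemma ex_series_Im (u : nat -> C) :
  ex_series (fun k => Cmod (u k)) -> ex_series (fun k => Im (u k)).
Proof. apply (ex_series_le (V := R_CompleteNormedModule)); intros n; apply Im_le_Cmod_abs. Qed.

Lemma ex_series_Cmod_le (u : nat -> C) (e : nat -> R) :
  (forall k, Cmod (u k) <= e k) -> ex_series e -> ex_series (fun k => Cmod (u k)).
Proof.
  intros Hue; apply (ex_series_le (V := R_CompleteNormedModule)); intros n.
  apply Rle_trans with (2 := Hue n); right; apply Rabs_pos_eq, Cmod_ge_0.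
Qed.

Lemma CSeries_ext (u v : nat -> C) : (forall k, u k = v k) -> CSeries u = CSeries v.
Proof. intros H; unfold CSeries; f_equal; apply Series_ext; intros k; now rewrite H. Qed.

Lemma CSeries_minus (u v : nat -> C) :
  ex_series (fun k => Cmod (u k)) -> ex_series (fun k => Cmod (v k)) ->
  CSeries (fun k => u k - v k)%C = (CSeries u - CSeries v)%C.
Proof.
  intros Hu Hv; unfold CSeries; apply injective_projections; simpl.
  - rewrite (Series_ext _ (fun k => Re (u k) - Re (v k))) by reflexivity.
    now apply Series_minus; apply ex_series_Re.
  - rewrite (Series_ext _ (fun k => Im (u k) - Im (v k))) by reflexivity.
    now apply Series_minus; apply ex_series_Im.
Qed.

Lemma CSeries_scal (c : C) (u : nat -> C) :
  ex_series (fun k => Cmod (u k)) ->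
  CSeries (fun k => c * u k)%C = (c * CSeries u)%C.
Proof.
  intros Hu; assert (HRe := ex_series_Re _ Hu); assert (HIm := ex_series_Im _ Hu).
  unfold CSeries; apply injective_projections; simpl; rewrite <- !Series_scal_l.
  - rewrite <- Series_minus; [reflexivity | now apply (ex_series_scal_l _ (fun k => Re (u k))) |
      now apply (ex_series_scal_l _ (fun k => Im (u k)))].
  - rewrite <- Series_plus; [reflexivity | now apply (ex_series_scal_l _ (fun k => Im (u k))) |
      now apply (ex_series_scal_l _ (fun k => Re (u k)))].
Qed.

Lemma CSeries_incr_1 (u : nat -> C) :
  ex_series (fun k => Cmod (u k)) ->
  CSeries u = (u 0%nat + CSeries (fun k => u (S k)))%C.
Proof.
  intros Hu; unfold CSeries; apply injective_projections; simpl.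
  - now apply (Series_incr_1 (fun k => Re (u k))), ex_series_Re.
  - now apply (Series_incr_1 (fun k => Im (u k))), ex_series_Im.
Qed.

(* With [S] the sum, [|S|^2] is the sum of the real parts of [conj S * u k],
   each at most [|S| * e k]. *)
Lemma Cmod_CSeries_le (u : nat -> C) (e : nat -> R) :
  (forall k, Cmod (u k) <= e k) -> ex_series e -> Cmod (CSeries u) <= Series e.
Proof.
  intros Hue He.
  assert (Hu := ex_series_Cmod_le u e Hue He).
  set (s := CSeries u).
  assert (Hs0 : 0 <= Cmod s) by apply Cmod_ge_0.
  assert (Hsq : Cmod s * Cmod s <= Cmod s * Series e).
  { assert (Cmod s * Cmod s = Re (Cconj s * s)) as -> by (rewrite Cmod_sqr; simpl; ring).
    unfold s at 2; rewrite <- CSeries_scal by assumption.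
    rewrite <- Series_scal_l; simpl.
    assert (Habs : forall k, Rabs (Re (Cconj s * u k)%C) <= Cmod s * e k).
    { intros k; apply Rle_trans with (1 := re_le_Cmod _).
      rewrite Cmod_mult, Cmod_conj; now apply Rmult_le_compat_l. }
    assert (Hse : ex_series (fun k => Cmod s * e k)) by now apply (ex_series_scal_l (Cmod s) e).
    assert (Hre : ex_series (fun k => Rabs (Re (Cconj s * u k)%C))).
    { revert Hse; apply (ex_series_le (V := R_CompleteNormedModule)).
      intros k; unfold norm; simpl; unfold abs; simpl; rewrite Rabs_Rabsolu; apply Habs. }
    apply Rle_trans with (1 := Rle_abs _).
    apply Rle_trans with (1 := Series_Rabs _ Hre).
    apply Series_le; [intros k; split; [apply Rabs_pos | apply Habs] | assumption]. }
  (* Cancelling |s| requires |s| > 0. If |s| = 0, what remains is that the sum of [e] is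
     nonnegative, its terms being bounds of moduli. *)
  destruct (Rle_lt_or_eq_dec _ _ Hs0) as [Hs | <-].
  - now apply Rmult_le_reg_l in Hsq.
  - replace 0 with (Series (fun k => 0 * e k)) by (rewrite Series_scal_l; ring).
    apply Series_le; [| assumption].
    intros k; rewrite Rmult_0_l; split; [lra |].
    apply Rle_trans with (2 := Hue k), Cmod_ge_0.
Qed.

(** The factor n is the weight of the coefficient of z^n in the contraction constant [q]. *)
Lemma Cmod_pow_minus_le (z w : C) (n : nat) : Cmod z <= 1 -> Cmod w <= 1 ->
  Cmod (z ^ n - w ^ n) <= INR n * Cmod (z - w).
Proof.
  intros Hz Hw; induction n as [| n IH].
  - simpl; replace (1 - 1)%C with (RtoC 0) by ring; rewrite Cmod_0; lra.
  - replace (z ^ S n - w ^ S n)%C with (z * (z ^ n - w ^ n) + w ^ n * (z - w))%C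
      by (simpl; ring).
    apply Rle_trans with (1 := Cmod_triangle _ _); rewrite !Cmod_mult, S_INR.
    assert (Hwn := Cmod_pow_le_1 w n Hw).
    assert (0 <= Cmod (z - w)) by apply Cmod_ge_0.
    assert (0 <= Cmod (z ^ n - w ^ n)) by apply Cmod_ge_0.
    assert (Cmod z * Cmod (z ^ n - w ^ n) <= 1 * Cmod (z ^ n - w ^ n))
      by now apply Rmult_le_compat_r.
    assert (Cmod (w ^ n) * Cmod (z - w) <= 1 * Cmod (z - w))
      by now apply Rmult_le_compat_r.
    lra.
Qed.

(** With N = n + 1, the remainder E_N of z^N satisfies E_(N+1) = w E_N + N z^n (w - z)^2, and N^2 +
    N <= (N + 1)^2. The crude constant N^2 is enough for differentiating term by term. *)
Lemma Cmod_pow_taylor_le (z w : C) (n : nat) : Cmod z <= 1 -> Cmod w <= 1 ->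
  Cmod (w ^ S n - z ^ S n - RtoC (INR (S n)) * z ^ n * (w - z))
  <= INR (S n) ^ 2 * (Cmod (w - z)) ^ 2.
Proof.
  intros Hz Hw; induction n as [| n IH].
  - match goal with |- Cmod ?x <= _ => replace x with (RtoC 0) by (simpl; ring) end.
    rewrite Cmod_0; apply Rmult_le_pos; apply pow2_ge_0.
  - set (E := (w ^ S n - z ^ S n - RtoC (INR (S n)) * z ^ n * (w - z))%C) in IH.
    match goal with |- Cmod ?x <= _ =>
      replace x with (w * E + RtoC (INR (S n)) * z ^ n * (w - z) ^ 2)%C end.
    2: { rewrite (S_INR (S n)), RtoC_plus; unfold E; simpl; ring. }
    apply Rle_trans with (1 := Cmod_triangle _ _).
    rewrite !Cmod_mult, Cmod_R, (Cmod_pow (w - z)).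
    assert (Hn0 : 0 <= INR (S n)) by apply pos_INR.
    rewrite (Rabs_pos_eq (INR (S n))), (S_INR (S n)) by assumption.
    assert (Hzn := Cmod_pow_le_1 z n Hz).
    assert (0 <= Cmod E) by apply Cmod_ge_0.
    assert (Hd : 0 <= Cmod (w - z) ^ 2) by apply pow2_ge_0.
    assert (Cmod w * Cmod E <= 1 * Cmod E) by now apply Rmult_le_compat_r.
    assert (INR (S n) * Cmod (z ^ n) * Cmod (w - z) ^ 2
            <= INR (S n) * 1 * Cmod (w - z) ^ 2)
      by (apply Rmult_le_compat_r; [assumption |]; now apply Rmult_le_compat_l).
    assert (0 <= (INR (S n) + 1) * Cmod (w - z) ^ 2) by (apply Rmult_le_pos; lra).
    replace ((INR (S n) + 1) ^ 2 * Cmod (w - z) ^ 2)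
      with (INR (S n) ^ 2 * Cmod (w - z) ^ 2 + INR (S n) * 1 * Cmod (w - z) ^ 2
            + (INR (S n) + 1) * Cmod (w - z) ^ 2) by ring.
    lra.
Qed.

(** Split off 1 - t u: what is left is u t (1 - u^n), at most n t |1 - u| in modulus. Moreover t |1
    - u| = |t - t u| <= |1 - t u|, since Re (t u) <= t <= 1. *)
Lemma Cmod_one_minus_scaled_pow_le (u : C) (t : R) (n : nat) :
  Cmod u <= 1 -> 0 <= t <= 1 ->
  Cmod (1 - RtoC t * u ^ S n) <= INR (S n) * Cmod (1 - RtoC t * u).
Proof.
  intros Hu Ht.
  replace (1 - RtoC t * u ^ S n)%C
    with ((1 - RtoC t * u) + u * (RtoC t * (1 - u ^ n)))%C by (simpl; ring).
  apply Rle_trans with (1 := Cmod_triangle _ _).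
  rewrite !Cmod_mult, Cmod_R, Rabs_pos_eq, S_INR by lra.
  assert (H1 : Cmod (1 - u ^ n) <= INR n * Cmod (1 - u)).
  { rewrite <- (Cpow_1_l n) at 1; apply Cmod_pow_minus_le; [rewrite Cmod_1; lra | assumption]. }
  assert (H2 : t * Cmod (1 - u) <= Cmod (1 - RtoC t * u)).
  { rewrite <- (Rabs_pos_eq t) at 1 by lra; rewrite <- Cmod_R, <- Cmod_mult.
    replace (RtoC t * (1 - u))%C with (RtoC t - RtoC t * u)%C by ring.
    apply Cmod_real_minus_le; split; [| lra].
    assert (Hre := Re_le_Cmod u); destruct u as [p q]; simpl in *.
    assert (t * p <= t * 1) by (apply Rmult_le_compat_l; lra); lra. }
  assert (t * Cmod (1 - u ^ n) <= INR n * (t * Cmod (1 - u))).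
  { replace (INR n * (t * Cmod (1 - u))) with (t * (INR n * Cmod (1 - u))) by ring.
    apply Rmult_le_compat_l; lra. }
  assert (INR n * (t * Cmod (1 - u)) <= INR n * Cmod (1 - RtoC t * u))
    by (apply Rmult_le_compat_l; [apply pos_INR | assumption]).
  assert (0 <= t * Cmod (1 - u ^ n)) by (apply Rmult_le_pos; [lra | apply Cmod_ge_0]).
  assert (Cmod u * (t * Cmod (1 - u ^ n)) <= 1 * (t * Cmod (1 - u ^ n)))
    by now apply Rmult_le_compat_r.
  lra.
Qed.

(** Completeness enters through absolutely convergent series: the increments [d] of the iterates
    decay like q^n, and [r n] is what remains to be added to [x n]. *)
Lemma C_contraction_fixpoint (T : C -> C) (q : R) :
  0 <= q < 1 -> (forall z w, Cmod (T z - T w) <= q * Cmod (z - w)) ->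
  exists z, T z = z.
Proof.
  intros Hq HT.
  set (x := fun n => Nat.iter n T (RtoC 0)).
  set (d := fun n => (x (S n) - x n)%C).
  set (D := Cmod (d 0%nat)).
  assert (Hd : forall n, Cmod (d n) <= D * q ^ n).
  { induction n as [| n IH]; [simpl; unfold D; lra |].
    apply Rle_trans with (q * Cmod (d n)); [apply HT |].
    replace (D * q ^ S n) with (q * (D * q ^ n)) by (simpl; ring).
    apply Rmult_le_compat_l; lra. }
  assert (Hgeom : forall n, ex_series (fun k => D * q ^ n * q ^ k)).
  { intros n; apply (ex_series_scal_l (D * q ^ n) (fun k => q ^ k)), ex_series_geom.
    rewrite Rabs_pos_eq; lra. }
  assert (Hdn : forall n k, Cmod (d (n + k)%nat) <= D * q ^ n * q ^ k).
  { intros n k; rewrite Rmult_assoc, <- pow_add; apply Hd. }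
  set (r := fun n => CSeries (fun k => d (n + k)%nat)).
  assert (Hr : forall n, Cmod (r n) <= D * / (1 - q) * q ^ n).
  { intros n; apply Rle_trans with (1 := Cmod_CSeries_le _ _ (Hdn n) (Hgeom n)).
    rewrite Series_scal_l, Series_geom by (rewrite Rabs_pos_eq; lra); right; ring. }
  assert (Hxr : forall n, (x n + r n = r 0%nat)%C).
  { induction n as [| n IH]; [unfold x; simpl; ring |].
    rewrite <- IH; unfold r at 2.
    rewrite CSeries_incr_1 by (apply (ex_series_Cmod_le _ _ (Hdn n)), Hgeom).
    rewrite Nat.add_0_r.
    rewrite (CSeries_ext (fun k => d (n + S k)%nat) (fun k => d (S n + k)%nat))
      by (intros k; f_equal; lia).
    unfold d at 1; fold (r (S n)); ring. }
  (* As [x 0] is 0, the sum of all increments is the limit of the iterates. *)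
  exists (r 0%nat).
  (* The two summands come from |T (r 0) - T (x n)| <= q |r n| and from |x (n + 1) - r 0| = |r (n +
     1)|. *)
  set (K := q * (D * / (1 - q)) + D * / (1 - q) * q).
  assert (Hlim : forall n, Cmod (T (r 0%nat) - r 0%nat) <= K * q ^ n).
  { intros n.
    replace (T (r 0%nat) - r 0%nat)%C with ((T (r 0%nat) - T (x n)) + - r (S n))%C.
    2: { assert (H := Hxr (S n)); change (x (S n)) with (T (x n)) in H; rewrite <- H at 3; ring. }
    apply Rle_trans with (1 := Cmod_triangle _ _); rewrite Cmod_opp.
    assert (H1 := HT (r 0%nat) (x n)).
    replace (r 0%nat - x n)%C with (r n) in H1 by (rewrite <- (Hxr n); ring).
    assert (H2 := Hr n); assert (H3 := Hr (S n)); simpl in H3.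
    apply (Rmult_le_compat_l q) in H2; [| lra].
    unfold K; lra. }
  assert (H0 : Cmod (T (r 0%nat) - r 0%nat) <= 0).
  { apply (is_lim_seq_le (fun _ => Cmod (T (r 0%nat) - r 0%nat)) (fun n => K * q ^ n)
             (Cmod (T (r 0%nat) - r 0%nat)) 0); [exact Hlim | apply is_lim_seq_const |].
    replace (Finite 0) with (Rbar_mult K 0) by (simpl; f_equal; ring).
    apply is_lim_seq_scal_l, is_lim_seq_geom; rewrite Rabs_pos_eq; lra. }
  assert (Hz : (T (r 0%nat) - r 0%nat)%C = RtoC 0)
    by (apply Cmod_eq_0, Rle_antisym; [assumption | apply Cmod_ge_0]).
  replace (T (r 0%nat)) with (T (r 0%nat) - r 0%nat + r 0%nat)%C by ring.
  rewrite Hz; ring.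
Qed.

(** * The metric projection onto the closed unit disk *)

Definition disk_proj (z : C) : C := (RtoC (/ Rmax 1 (Cmod z)) * z)%C.

Lemma disk_proj_scale (z : C) : z = (RtoC (Rmax 1 (Cmod z)) * disk_proj z)%C.
Proof.
  assert (1 <= Rmax 1 (Cmod z)) by apply Rmax_l.
  unfold disk_proj; rewrite Cmult_assoc, <- RtoC_mult, Rinv_r by lra; ring.
Qed.

Lemma disk_proj_id (z : C) : Cmod z <= 1 -> disk_proj z = z.
Proof.
  intros Hz; unfold disk_proj; rewrite Rmax_left by assumption.
  rewrite Rinv_1; ring.
Qed.

Lemma Cmod_disk_proj_far (z : C) : 1 <= Cmod z -> Cmod (disk_proj z) = 1.
Proof.
  intros Hz; unfold disk_proj; rewrite Rmax_right by assumption.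
  rewrite Cmod_mult, Cmod_R, Rabs_pos_eq by (left; apply Rinv_0_lt_compat; lra).
  field; lra.
Qed.

Lemma Cmod_disk_proj_le (z : C) : Cmod (disk_proj z) <= 1.
Proof.
  destruct (Rle_dec (Cmod z) 1) as [Hz | Hz].
  - now rewrite disk_proj_id.
  - rewrite Cmod_disk_proj_far; lra.
Qed.

(** With A = |z|^2 and c the real inner product of z and w, the squared moduli differ by (m n - 1)
    (1 + A - 2 c) + (n - m) (n - m A). Here 1 + A - 2 c = |z - w|^2 and A <= 1, so both products are
    nonnegative. *)
Lemma Cmod_radial_stretch (z w : C) (m n : R) :
  Cmod z <= 1 -> Cmod w = 1 -> 1 <= m <= n ->
  Cmod (z - w) <= Cmod (RtoC m * z - RtoC n * w).
Proof.
  intros Hz Hw Hmn; apply Cmod_le_of_sqr.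
  assert (Hz2 := Cmod_sqr z); assert (Hw2 := Cmod_sqr w).
  assert (Cmod z * Cmod z <= 1) by (assert (H := Cmod_ge_0 z); nra).
  rewrite Hw in Hw2; destruct z as [p q], w as [r s]; simpl in *.
  set (A := p * p + q * q) in *; set (c := p * r + q * s).
  assert (Hc : 2 * c <= 1 + A).
  { assert (0 <= (p - r) * (p - r)) by apply Rle_0_sqr.
    assert (0 <= (q - s) * (q - s)) by apply Rle_0_sqr.
    unfold c, A; lra. }
  assert (0 <= (m * n - 1) * (1 + A - 2 * c)) by (apply Rmult_le_pos; nra).
  assert (0 <= (n - m) * (n - m * A)) by (apply Rmult_le_pos; nra).
  assert (0 <= m * n - 1) by nra.
  assert (m * m * A - 2 * m * n * c + n * n - (A - 2 * c + 1) >= 0) by nra.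
  replace ((m * p - 0 * q + - (n * r - 0 * s)) * (m * p - 0 * q + - (n * r - 0 * s))
    + (m * q + 0 * p + - (n * s + 0 * r)) * (m * q + 0 * p + - (n * s + 0 * r)))
    with (m * m * A - 2 * m * n * c + n * n * (r * r + s * s)) by (unfold A, c; ring).
  replace ((p + - r) * (p + - r) + (q + - s) * (q + - s))
    with (A - 2 * c + (r * r + s * s)) by (unfold A, c; ring).
  rewrite <- Hw2; lra.
Qed.

Lemma disk_proj_nonexpansive (z w : C) :
  Cmod (disk_proj z - disk_proj w) <= Cmod (z - w).
Proof.
  (* By symmetry the point of larger modulus comes second: either both points lie in the disk, or
     [y] projects onto the circle. *)
  assert (H : forall x y, Cmod x <= Cmod y -> Cmod (disk_proj x - disk_proj y) <= Cmod (x - y)).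
  { intros x y Hxy; destruct (Rle_dec (Cmod y) 1) as [Hy | Hy].
    - rewrite !disk_proj_id; lra.
    - rewrite (disk_proj_scale x) at 2; rewrite (disk_proj_scale y) at 2.
      apply Cmod_radial_stretch.
      + apply Cmod_disk_proj_le.
      + apply Cmod_disk_proj_far; lra.
      + split; [apply Rmax_l | now apply Rle_max_compat_l]. }
  destruct (Rle_dec (Cmod z) (Cmod w)); [now apply H |].
  rewrite Cmod_minus_comm, (Cmod_minus_comm z); apply H; lra.
Qed.

(** * Perturbations of the identity by power series with small coefficients *)

Definition tail_series (a : nat -> R) (z : C) : C :=
  CSeries (fun k => RtoC (a k) * z ^ S (S k))%C.

(** The classical criterion: the sum of n |a_n| over n >= 2 is less than 1, with n = k + 2.
    Summability with weight n^2 controls the second-order remainder, and it makes the last sum a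
    genuine one, as [Series] has a value on divergent series too. *)
Definition starlike_coeffs (a : nat -> R) : Prop :=
  (forall k, 0 <= a k) /\
  ex_series (fun k => INR (S (S k)) ^ 2 * a k) /\
  Series (fun k => INR (S (S k)) * a k) < 1.

Lemma INR_SS_ge_2 (k : nat) : 2 <= INR (S (S k)).
Proof. rewrite !S_INR; assert (H := pos_INR k); lra. Qed.

Lemma starlike_coeffs_ex_series (a b : nat -> R) :
  starlike_coeffs b -> (forall k, 0 <= a k <= INR (S (S k)) ^ 2 * b k) -> ex_series a.
Proof.
  intros (_ & Hb & _) Hab; revert Hb; apply (ex_series_le (V := R_CompleteNormedModule)).
  intros k; apply Rle_trans with (a k); [right; apply Rabs_pos_eq |]; apply Hab.
Qed.

Lemma starlike_coeffs_ex_series_1 (a : nat -> R) :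
  starlike_coeffs a -> ex_series (fun k => INR (S (S k)) * a k).
Proof.
  intros Ha; apply (starlike_coeffs_ex_series _ a Ha); intros k.
  destruct Ha as (Hp & _); specialize (Hp k); assert (Hn := INR_SS_ge_2 k).
  assert (0 <= INR (S (S k)) * a k) by (apply Rmult_le_pos; lra).
  assert (0 <= (INR (S (S k)) * a k) * (INR (S (S k)) - 2)) by (apply Rmult_le_pos; lra).
  nra.
Qed.

Lemma starlike_coeffs_ex_series_0 (a : nat -> R) : starlike_coeffs a -> ex_series a.
Proof.
  intros Ha; apply (starlike_coeffs_ex_series _ a Ha); intros k.
  destruct Ha as (Hp & _); specialize (Hp k); assert (Hn := INR_SS_ge_2 k).
  assert (0 <= INR (S (S k)) * a k) by (apply Rmult_le_pos; lra).
  assert (0 <= (INR (S (S k)) * a k) * (INR (S (S k)) - 2)) by (apply Rmult_le_pos; lra).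
  nra.
Qed.

Lemma starlike_coeffs_le (a b : nat -> R) :
  (forall k, 0 <= a k <= b k) -> starlike_coeffs b -> starlike_coeffs a.
Proof.
  intros Hab Hb.
  assert (Hnab : forall k, 0 <= INR (S (S k)) * a k <= INR (S (S k)) * b k).
  { intros k; destruct (Hab k); assert (Hn := INR_SS_ge_2 k).
    split; [apply Rmult_le_pos | apply Rmult_le_compat_l]; lra. }
  split; [intros k; apply Hab | split].
  - apply (starlike_coeffs_ex_series _ b Hb); intros k; destruct (Hab k).
    assert (0 <= INR (S (S k)) ^ 2) by apply pow2_ge_0.
    split; [now apply Rmult_le_pos | now apply Rmult_le_compat_l].
  - apply Rle_lt_trans with (2 := proj2 (proj2 Hb)).
    apply Series_le; [exact Hnab | now apply starlike_coeffs_ex_series_1].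
Qed.

Lemma weighted_sum_nonneg (a : nat -> R) : starlike_coeffs a ->
  0 <= Series (fun k => INR (S (S k)) * a k).
Proof.
  intros Ha; replace 0 with (Series (fun k => 0 * (INR (S (S k)) * a k)))
    by (rewrite Series_scal_l; ring).
  apply Series_le; [| now apply starlike_coeffs_ex_series_1].
  intros k; destruct Ha as (Hp & _); specialize (Hp k).
  assert (Hn := INR_SS_ge_2 k); assert (0 <= INR (S (S k)) * a k) by (apply Rmult_le_pos; lra).
  lra.
Qed.

Lemma Cmod_coeff_pow_le (c : R) (z : C) (n : nat) :
  0 <= c -> Cmod z <= 1 -> Cmod (RtoC c * z ^ n) <= c.
Proof.
  intros Hc Hz; rewrite Cmod_mult, Cmod_R, Rabs_pos_eq by assumption.
  rewrite <- (Rmult_1_r c) at 2; apply Rmult_le_compat_l; [assumption |].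
  now apply Cmod_pow_le_1.
Qed.

Lemma ex_series_coeff_pow (c : nat -> R) (n : nat -> nat) (z : C) :
  (forall k, 0 <= c k) -> ex_series c -> Cmod z <= 1 ->
  ex_series (fun k => Cmod (RtoC (c k) * z ^ n k)).
Proof.
  intros Hc Hs Hz; apply (ex_series_Cmod_le _ c); [| assumption].
  intros k; now apply Cmod_coeff_pow_le.
Qed.

Lemma ex_series_tail (a : nat -> R) (z : C) : starlike_coeffs a -> Cmod z <= 1 ->
  ex_series (fun k => Cmod (RtoC (a k) * z ^ S (S k))).
Proof.
  intros Ha Hz; apply ex_series_coeff_pow; [apply Ha | | assumption].
  now apply starlike_coeffs_ex_series_0.
Qed.

Lemma tail_series_lipschitz (a : nat -> R) (z w : C) :
  starlike_coeffs a -> Cmod z <= 1 -> Cmod w <= 1 ->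
  Cmod (tail_series a z - tail_series a w)
  <= Series (fun k => INR (S (S k)) * a k) * Cmod (z - w).
Proof.
  intros Ha Hz Hw; unfold tail_series.
  rewrite <- CSeries_minus by now apply ex_series_tail.
  rewrite <- Series_scal_r; apply Cmod_CSeries_le.
  - intros k; replace (RtoC (a k) * z ^ S (S k) - RtoC (a k) * w ^ S (S k))%C
      with (RtoC (a k) * (z ^ S (S k) - w ^ S (S k)))%C by ring.
    destruct Ha as (Hp & _); rewrite Cmod_mult, Cmod_R, Rabs_pos_eq by apply Hp.
    replace (INR (S (S k)) * a k * Cmod (z - w))
      with (a k * (INR (S (S k)) * Cmod (z - w))) by ring.
    apply Rmult_le_compat_l; [apply Hp | now apply Cmod_pow_minus_le].
  - now apply (ex_series_scal_r (Cmod (z - w))), starlike_coeffs_ex_series_1.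
Qed.

(** A solution is a fixed point of z -> w - h (P z). Since [P] is nonexpansive with values in the
    closed disk, this is a [q]-contraction of the whole plane, and no invariant disk has to be
    found. *)
Lemma disk_extension_fixpoint (a : nat -> R) (w : C) : starlike_coeffs a ->
  exists z, (z + tail_series a (disk_proj z) = w)%C.
Proof.
  intros Ha.
  destruct (C_contraction_fixpoint (fun z => w - tail_series a (disk_proj z))%C
              (Series (fun k => INR (S (S k)) * a k))) as [z Hz].
  - split; [now apply weighted_sum_nonneg | apply Ha].
  - intros x y.
    replace (w - tail_series a (disk_proj x) - (w - tail_series a (disk_proj y)))%C
      with (tail_series a (disk_proj y) - tail_series a (disk_proj x))%C by ring.
    rewrite Cmod_minus_comm.
    apply Rle_trans with (1 := tail_series_lipschitz a _ _ Ha
                                 (Cmod_disk_proj_le x) (Cmod_disk_proj_le y)).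
    apply Rmult_le_compat_l; [now apply weighted_sum_nonneg | apply disk_proj_nonexpansive].
  - exists z; rewrite <- Hz at 1; ring.
Qed.

(* If [1 <= Cmod z], put [e = z / Cmod z] and [z0 = u e]; then the equation reads
   [(Cmod z - t u) e = sum of a k (t u^n - 1) e^n], whose right-hand side is at most
   [q |1 - t u| <= q |Cmod z - t u|] with [q < 1], although [|t u| < 1 <= Cmod z]. *)
Lemma shrunk_value_preimage_in_disk (a : nat -> R) (z z0 : C) (t : R) :
  starlike_coeffs a -> Cmod z0 < 1 -> 0 <= t <= 1 ->
  (z + tail_series a (disk_proj z) = RtoC t * (z0 + tail_series a z0))%C ->
  Cmod z < 1.
Proof.
  intros Ha Hz0 Ht Heq; apply Rnot_le_lt; intros Hz.
  set (r := Cmod z) in *; set (e := disk_proj z) in *.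
  assert (He : Cmod e = 1) by now apply Cmod_disk_proj_far.
  assert (Hze : z = (RtoC r * e)%C).
  { rewrite (disk_proj_scale z) at 1; fold r; now rewrite Rmax_right. }
  assert (Hne : e <> RtoC 0) by (intros H0; rewrite H0, Cmod_0 in He; lra).
  set (u := (z0 / e)%C).
  assert (Hz0u : z0 = (u * e)%C) by (unfold u; field; assumption).
  assert (Hu : Cmod u < 1).
  { unfold u; rewrite Cmod_div by assumption; rewrite He; unfold Rdiv; rewrite Rinv_1; lra. }
  set (q := Series (fun k => INR (S (S k)) * a k)).
  assert (Hq : 0 <= q < 1) by (split; [now apply weighted_sum_nonneg | apply Ha]).
  assert (H1 : Cmod (RtoC t * tail_series a z0 - tail_series a e) <= q * Cmod (1 - RtoC t * u)).
  { unfold tail_series, q.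
    rewrite <- CSeries_scal by (apply ex_series_tail; [assumption | lra]).
    rewrite <- CSeries_minus.
    3: { apply ex_series_tail; [assumption | lra]. }
    2: { apply (ex_series_ext (fun k => t * Cmod (RtoC (a k) * z0 ^ S (S k)))).
         - intros k; symmetry; rewrite (Cmod_mult (RtoC t)), Cmod_R, Rabs_pos_eq by lra.
           reflexivity.
         - apply (ex_series_scal_l t (fun k => Cmod (RtoC (a k) * z0 ^ S (S k)))).
           apply ex_series_tail; [assumption | lra]. }
    rewrite <- Series_scal_r; apply Cmod_CSeries_le.
    - intros k.
      replace (RtoC t * (RtoC (a k) * z0 ^ S (S k)) - RtoC (a k) * e ^ S (S k))%C
        with (- (RtoC (a k) * e ^ S (S k) * (1 - RtoC t * u ^ S (S k))))%C
        by (rewrite Hz0u, Cpow_mult_l; ring).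
      rewrite Cmod_opp, Cmod_mult.
      replace (INR (S (S k)) * a k * Cmod (1 - RtoC t * u))
        with (a k * (INR (S (S k)) * Cmod (1 - RtoC t * u))) by ring.
      apply Rmult_le_compat; try apply Cmod_ge_0.
      + apply Cmod_coeff_pow_le; [apply Ha | lra].
      + apply Cmod_one_minus_scaled_pow_le; lra.
    - now apply (ex_series_scal_r (Cmod (1 - RtoC t * u))), starlike_coeffs_ex_series_1. }
  assert (Htu : Cmod (RtoC t * u) < 1).
  { rewrite Cmod_mult, Cmod_R, Rabs_pos_eq by lra.
    assert (t * Cmod u <= 1 * Cmod u)
      by (apply Rmult_le_compat_r; [apply Cmod_ge_0 | lra]); lra. }
  assert (Hre := Re_le_Cmod (RtoC t * u)%C).
  assert (H2 : Cmod (1 - RtoC t * u) <= Cmod (RtoC r - RtoC t * u))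
    by (apply Cmod_real_minus_le; lra).
  assert (H3 : Cmod (RtoC r - RtoC t * u) = Cmod (RtoC t * tail_series a z0 - tail_series a e)).
  { rewrite <- (Rmult_1_r (Cmod _)), <- He, <- Cmod_mult; f_equal.
    replace (RtoC t * tail_series a z0)%C
      with (RtoC t * (z0 + tail_series a z0) - RtoC t * z0)%C by ring.
    rewrite <- Heq, Hze, Hz0u at 1; ring. }
  (* This gives |r - t u| > 0, so |r - t u| <= q |1 - t u| <= q |r - t u| contradicts q < 1. *)
  assert (H4 := Cmod_minus_le (RtoC r) (RtoC t * u)).
  rewrite Cmod_R, Rabs_pos_eq in H4 by lra; nra.
Qed.

(** * Neighbourhoods and complex derivatives *)

(** A ball of the product R * R is a square, which costs a factor sqrt 2, here rounded up to 2. *)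
Lemma Cmod_of_ball (x y : C) (eps : posreal) : ball x eps y -> Cmod (y - x) < 2 * eps.
Proof.
  intros H; apply C_NormedModule_mixin_compat2 in H.
  apply Rlt_le_trans with (1 := H); apply Rmult_le_compat_r; [left; apply cond_pos |].
  rewrite <- (sqrt_square 2) at 2 by lra; apply sqrt_le_1_alt; lra.
Qed.

Definition tail_derivative (a : nat -> R) (z : C) : C :=
  CSeries (fun k => RtoC (INR (S (S k)) * a k) * z ^ S k)%C.

Lemma ex_series_tail_derivative (a : nat -> R) (z : C) : starlike_coeffs a -> Cmod z <= 1 ->
  ex_series (fun k => Cmod (RtoC (INR (S (S k)) * a k) * z ^ S k)).
Proof.
  intros Ha Hz; apply (ex_series_coeff_pow (fun k => INR (S (S k)) * a k));
    [| now apply starlike_coeffs_ex_series_1 | assumption].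
  intros k; apply Rmult_le_pos; [apply pos_INR | apply Ha].
Qed.

Lemma tail_series_taylor (a : nat -> R) (z w : C) :
  starlike_coeffs a -> Cmod z <= 1 -> Cmod w <= 1 ->
  Cmod (tail_series a w - tail_series a z - (w - z) * tail_derivative a z)
  <= Series (fun k => INR (S (S k)) ^ 2 * a k) * Cmod (w - z) ^ 2.
Proof.
  intros Ha Hz Hw; unfold tail_series, tail_derivative.
  assert (Hz1 := ex_series_tail a z Ha Hz); assert (Hw1 := ex_series_tail a w Ha Hw).
  assert (Hd := ex_series_tail_derivative a z Ha Hz).
  rewrite <- CSeries_scal by assumption.
  rewrite <- CSeries_minus by assumption.
  rewrite <- CSeries_minus.
  - rewrite <- Series_scal_r; apply Cmod_CSeries_le.
    + intros k.
      match goal with |- Cmod ?x <= _ => replace x with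
        (RtoC (a k) * (w ^ S (S k) - z ^ S (S k) - RtoC (INR (S (S k))) * z ^ S k * (w - z)))%C
        by (rewrite RtoC_mult; ring) end.
      destruct Ha as (Hp & _); rewrite Cmod_mult, Cmod_R, Rabs_pos_eq by apply Hp.
      rewrite (Rmult_comm _ (a k)), Rmult_assoc.
      apply Rmult_le_compat_l; [apply Hp | now apply Cmod_pow_taylor_le].
    + apply (ex_series_scal_r (Cmod (w - z) ^ 2)), Ha.
  - apply (ex_series_Cmod_le _ (fun k => Cmod (RtoC (a k) * w ^ S (S k))
                                         + Cmod (RtoC (a k) * z ^ S (S k)))).
    + intros k; apply Rle_trans with (1 := Cmod_triangle _ _); rewrite Cmod_opp; lra.
    + now apply (ex_series_plus (V := R_NormedModule)).
  - apply (ex_series_ext (fun k => Cmod (w - z) * Cmod (RtoC (INR (S (S k)) * a k) * z ^ S k))).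
    + intros k; symmetry; apply Cmod_mult.
    + now apply (ex_series_scal_l (Cmod (w - z))
                   (fun k => Cmod (RtoC (INR (S (S k)) * a k) * z ^ S k))).
Qed.

Lemma is_derive_of_quadratic_remainder (f : C -> C) (z l : C) (M eps : R) :
  0 < eps -> 0 <= M ->
  (forall w, Cmod (w - z) <= eps -> Cmod (f w - f z - (w - z) * l) <= M * Cmod (w - z) ^ 2) ->
  is_derive (K := C_AbsRing) (V := C_NormedModule) f z l.
Proof.
  intros Heps HM Hrem; split.
  - apply (is_linear_scal_l (K := C_AbsRing) (V := C_NormedModule)).
  - intros x Hx; 
    apply (is_filter_lim_locally_unique (V := AbsRing_NormedModule C_AbsRing)) in Hx.
    subst x; intros d.
    (* At distance at most d / (M + 1), the bound M |w - z|^2 is at most d |w - z|; M + 1 is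
       positive even when M = 0. *)
    set (m := Rmin eps (d / (M + 1))).
    assert (Hm : 0 < m / 2).
    { unfold m; apply Rdiv_lt_0_compat; [| lra].
      apply Rmin_pos; [assumption | apply Rdiv_lt_0_compat; [apply cond_pos | lra]]. }
    (* The neighbourhoods are now those of the absolute ring, whose balls are disks. *)
    exists (mkposreal _ Hm); intros w Hw; change (Cmod (w - z) < m / 2) in Hw.
    change (Cmod (f w - f z - (w - z) * l) <= d * Cmod (w - z)).
    assert (m <= eps) by apply Rmin_l.
    assert (Hmd : m <= d / (M + 1)) by apply Rmin_r.
    apply Rle_trans with (1 := Hrem w ltac:(lra)).
    assert (0 <= Cmod (w - z)) by apply Cmod_ge_0.
    replace (M * Cmod (w - z) ^ 2) with (M * Cmod (w - z) * Cmod (w - z)) by ring.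
    apply Rmult_le_compat_r; [assumption |].
    apply Rle_trans with ((M + 1) * (d / (M + 1))); [| right; field; lra].
    apply Rmult_le_compat; lra.
Qed.

Lemma is_derive_id_plus_tail (a : nat -> R) (f : C -> C) (z : C) :
  starlike_coeffs a -> (forall w, Cmod w <= 1 -> f w = (w + tail_series a w)%C) ->
  Cmod z < 1 ->
  is_derive (K := C_AbsRing) (V := C_NormedModule) f z (1 + tail_derivative a z)%C.
Proof.
  intros Ha Hf Hz.
  set (M := Series (fun k => INR (S (S k)) ^ 2 * a k)).
  (* The radius 1 - |z| keeps [w] in the closed disk, where [f] is known; [Rmax 0 M] is nonnegative
     by construction. *)
  apply (is_derive_of_quadratic_remainder f z _ (Rmax 0 M) (1 - Cmod z)); [lra | apply Rmax_l |].
  intros w Hw.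
  assert (Hw1 : Cmod w <= 1) by (assert (H := Cmod_minus_le w z); lra).
  rewrite !Hf by lra.
  match goal with |- Cmod ?x <= _ => replace x with
    (tail_series a w - tail_series a z - (w - z) * tail_derivative a z)%C by ring end.
  apply Rle_trans with (M * Cmod (w - z) ^ 2).
  - apply tail_series_taylor; [assumption | lra | assumption].
  - apply Rmult_le_compat_r; [apply pow2_ge_0 | apply Rmax_r].
Qed.

Lemma Cpow_0_S (n : nat) : (RtoC 0 ^ S n = RtoC 0)%C.
Proof. simpl; ring. Qed.

Lemma CSeries_zero (u : nat -> C) : (forall k, u k = RtoC 0) -> CSeries u = RtoC 0.
Proof.
  intros Hu; unfold CSeries; apply injective_projections; simpl.
  - rewrite (Series_ext _ (fun k => 0 * 0)) by (intros k; rewrite Hu; simpl; ring).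
    rewrite Series_scal_l; ring.
  - rewrite (Series_ext _ (fun k => 0 * 0)) by (intros k; rewrite Hu; simpl; ring).
    rewrite Series_scal_l; ring.
Qed.

Lemma tail_series_0 (a : nat -> R) : tail_series a (RtoC 0) = RtoC 0.
Proof. apply CSeries_zero; intros k; rewrite Cpow_0_S; ring. Qed.

Lemma tail_derivative_0 (a : nat -> R) : tail_derivative a (RtoC 0) = RtoC 0.
Proof. apply CSeries_zero; intros k; rewrite Cpow_0_S; ring. Qed.

(** * Starlikeness and close-to-convexity from the coefficients *)

Lemma normalized_id_plus_tail (a : nat -> R) (f : C -> C) :
  starlike_coeffs a -> (forall w, Cmod w <= 1 -> f w = (w + tail_series a w)%C) ->
  normalized_analytic f.
Proof.
  intros Ha Hf; split; [| split].
  - intros z Hz; eexists; now apply (is_derive_id_plus_tail a).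
  - rewrite Hf by (rewrite Cmod_0; lra); rewrite tail_series_0; ring.
  - rewrite (is_C_derive_unique f _ (1 + tail_derivative a (RtoC 0))%C).
    + rewrite tail_derivative_0; ring.
    + apply is_derive_id_plus_tail; auto; rewrite Cmod_0; lra.
Qed.

Lemma starlike_id_plus_tail (a : nat -> R) (f : C -> C) :
  starlike_coeffs a -> (forall w, Cmod w <= 1 -> f w = (w + tail_series a w)%C) ->
  starlike f.
Proof.
  intros Ha Hf; assert (Hn := normalized_id_plus_tail a f Ha Hf).
  set (q := Series (fun k => INR (S (S k)) * a k)).
  assert (Hq : 0 <= q < 1) by (split; [now apply weighted_sum_nonneg | apply Ha]).
  split; [exact Hn | split; [split; [apply Hn |] | split; [| split]]].
  (* Equal values give |z - w| = |h w - h z| <= q |z - w| with q < 1. *)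
  - unfold unit_disk; intros z w Hz Hw Heq; rewrite !Hf in Heq by lra.
    assert (H := tail_series_lipschitz a w z Ha ltac:(lra) ltac:(lra)); fold q in H.
    replace (tail_series a w - tail_series a z)%C
      with (w + tail_series a w - tail_series a z - w)%C in H by ring.
    rewrite <- Heq in H.
    replace (z + tail_series a z - tail_series a z - w)%C with (z - w)%C in H by ring.
    rewrite (Cmod_minus_comm w) in H.
    assert (0 <= Cmod (z - w)) by apply Cmod_ge_0.
    assert (Hzw : Cmod (z - w) = 0) by nra.
    apply Cmod_eq_0 in Hzw.
    replace z with (z - w + w)%C by ring; rewrite Hzw; ring.
  - intros w0 (z0 & Hz0 & <-); unfold unit_disk in Hz0.
    (* The factor 2 of [Cmod_of_ball] turns this into |w - f z0| < (1 - q) (1 - |z0|). The solution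
       [z] satisfies (1 - q) |z - z0| <= |w - f z0|, hence |z| < 1. *)
    assert (Heps : 0 < (1 - q) * (1 - Cmod z0) / 2)
      by (apply Rdiv_lt_0_compat; [apply Rmult_lt_0_compat |]; lra).
    exists (mkposreal _ Heps); intros w Hw; apply Cmod_of_ball in Hw; simpl in Hw.
    destruct (disk_extension_fixpoint a w Ha) as [z Hz].
    assert (Hlip := tail_series_lipschitz a _ _ Ha (Cmod_disk_proj_le z) (Cmod_disk_proj_le z0)).
    fold q in Hlip.
    assert (Hpr := disk_proj_nonexpansive z z0).
    apply (Rmult_le_compat_l q) in Hpr; [| lra].
    assert (Htri := Cmod_triangle (w - f z0)
                      (- (tail_series a (disk_proj z) - tail_series a (disk_proj z0)))).
    rewrite Cmod_opp in Htri.
    match type of Htri with Cmod ?x <= _ => replace x with (z - z0)%C in Htri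
      by (rewrite <- Hz, Hf, (disk_proj_id z0) by lra; ring) end.
    assert (Hmin := Cmod_minus_le z z0).
    assert (Hz1 : Cmod z < 1) by nra.
    exists z; split; [exact Hz1 |].
    rewrite Hf by lra; rewrite disk_proj_id in Hz by lra; exact Hz.
  - exists (RtoC 0); split; [unfold unit_disk; rewrite Cmod_0; lra | apply Hn].
  - intros w t (z0 & Hz0 & <-) Ht; unfold unit_disk in Hz0.
    destruct (disk_extension_fixpoint a (RtoC t * f z0) Ha) as [z Hz].
    assert (Hz1 : Cmod z < 1).
    { rewrite (Hf z0) in Hz by lra.
      now apply (shrunk_value_preimage_in_disk a z z0 t). }
    exists z; split; [exact Hz1 |].
    rewrite Hf by lra; rewrite disk_proj_id in Hz by lra; exact Hz.
Qed.

(** The hypothesis places x / y at distance less than 1 from 1. *)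
Lemma Re_div_pos (x y : C) : Cmod (x - y) < Cmod y -> 0 < Re (x / y)%C.
Proof.
  intros H.
  assert (H0 : 0 <= Cmod (x - y)) by apply Cmod_ge_0.
  assert (Hsq : Cmod (x - y) * Cmod (x - y) < Cmod y * Cmod y) by nra.
  rewrite !Cmod_sqr in Hsq; destruct x as [p q], y as [r s]; simpl in *.
  assert (Hp := Rle_0_sqr (p + - r)); assert (Hq := Rle_0_sqr (q + - s)).
  assert (Hp' := Rle_0_sqr p); assert (Hq' := Rle_0_sqr q); unfold Rsqr in *.
  assert (Hd : 0 < r * r + s * s) by lra.
  replace (p * (r / (r * (r * 1) + s * (s * 1))) - q * (- s / (r * (r * 1) + s * (s * 1))))
    with ((p * r + q * s) / (r * r + s * s)) by (field; lra).
  apply Rdiv_lt_0_compat; lra.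
Qed.

(* [|z f' - g| <= |z| sum (n - 1) b_n < |z| (1 - sum b_n) <= |g|]. *)
Lemma close_to_convex_id_plus_tail (a b : nat -> R) (f g : C -> C) :
  starlike_coeffs b -> (forall k, 0 <= a k <= b k) ->
  (forall w, Cmod w <= 1 -> f w = (w + tail_series a w)%C) ->
  (forall w, Cmod w <= 1 -> g w = (w + tail_series b w)%C) ->
  close_to_convex_wrt f g.
Proof.
  intros Hb Hab Hf Hg; assert (Ha := starlike_coeffs_le a b Hab Hb).
  split; [now apply (normalized_id_plus_tail a) |].
  split; [now apply (starlike_id_plus_tail b) |].
  unfold unit_disk; intros z Hz Hz0; apply Re_div_pos.
  rewrite (is_C_derive_unique f z (1 + tail_derivative a z)%C)
    by now apply is_derive_id_plus_tail.
  rewrite Hg by lra.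
  assert (Hzpos : 0 < Cmod z) by now apply Cmod_gt_0.
  assert (Hb0 := starlike_coeffs_ex_series_0 b Hb).
  assert (Hb1 := starlike_coeffs_ex_series_1 b Hb).
  assert (H1 : Cmod (tail_series b z) <= Series b * Cmod z).
  { rewrite <- Series_scal_r; apply Cmod_CSeries_le.
    - intros k; replace (RtoC (b k) * z ^ S (S k))%C with (RtoC (b k) * z ^ S k * z)%C
        by (simpl; ring).
      rewrite Cmod_mult; apply Rmult_le_compat_r; [lra |].
      apply Cmod_coeff_pow_le; [apply Hb | lra].
    - now apply (ex_series_scal_r (Cmod z)). }
  assert (H2 : Cmod (z * (1 + tail_derivative a z) - (z + tail_series b z))
               <= (Series (fun k => INR (S (S k)) * b k) - Series b) * Cmod z).
  { replace (z * (1 + tail_derivative a z) - (z + tail_series b z))%C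
      with (z * tail_derivative a z - tail_series b z)%C by ring.
    unfold tail_series, tail_derivative.
    rewrite <- CSeries_scal by (apply ex_series_tail_derivative; [assumption | lra]).
    rewrite <- CSeries_minus.
    - rewrite <- Series_minus, <- Series_scal_r by assumption; apply Cmod_CSeries_le.
      + intros k.
        replace (z * (RtoC (INR (S (S k)) * a k) * z ^ S k) - RtoC (b k) * z ^ S (S k))%C
          with (RtoC (INR (S (S k)) * a k - b k) * z ^ S k * z)%C
          by (rewrite RtoC_minus; simpl; ring).
        rewrite Cmod_mult; apply Rmult_le_compat_r; [lra |].
        rewrite Cmod_mult, Cmod_R.
        assert (Hn := INR_SS_ge_2 k); specialize (Hab k).
        assert (Cmod (z ^ S k) <= 1) by (apply Cmod_pow_le_1; lra).
        apply Rle_trans with (Rabs (INR (S (S k)) * a k - b k) * 1);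
          [apply Rmult_le_compat_l; [apply Rabs_pos | assumption] |].
        (* With n = k + 2: n a_k - b_k <= (n - 1) b_k as a_k <= b_k, and n a_k - b_k >= - b_k >= -
           (n - 1) b_k as n >= 2. *)
        rewrite Rmult_1_r; apply Rabs_le; split; nra.
      + apply (ex_series_scal_r (Cmod z) (fun k => INR (S (S k)) * b k - b k)).
        now apply (ex_series_minus (V := R_NormedModule)).
    - apply (ex_series_ext (fun k => Cmod z * Cmod (RtoC (INR (S (S k)) * a k) * z ^ S k))).
      + intros k; symmetry; apply Cmod_mult.
      + apply (ex_series_scal_l (Cmod z)
                 (fun k => Cmod (RtoC (INR (S (S k)) * a k) * z ^ S k))).
        apply ex_series_tail_derivative; [assumption | lra].
    - apply ex_series_tail; [assumption | lra]. }
  assert (H3 := Cmod_minus_le z (- tail_series b z)).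
  rewrite Cmod_opp in H3.
  replace (z - - tail_series b z)%C with (z + tail_series b z)%C in H3 by ring.
  assert (Hq := proj2 (proj2 Hb)); nra.
Qed.

(** * The Wright function *)

(** Index [k] belongs to z^(k+1), so the tail of the Wright function has the coefficients at
    [S k]. *)
Definition wright_coeff (mu a nu b : R) (k : nat) : R :=
  Gamma a * Gamma b / (Gamma (a + INR k * mu) * Gamma (b + INR k * nu)).

Lemma wright_coeff_0 (mu a nu b : R) : 1 <= a -> 1 <= b -> wright_coeff mu a nu b 0 = 1.
Proof.
  intros Ha Hb; unfold wright_coeff; simpl.
  rewrite !Rmult_0_l, !Rplus_0_r.
  assert (H1 := Gamma_pos a Ha); assert (H2 := Gamma_pos b Hb); field; lra.
Qed.

Lemma wright_coeff_succ (a b : R) (k : nat) : 1 <= a -> 1 <= b ->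
  wright_coeff 1 a 1 b (S k) = wright_coeff 1 a 1 b k / ((a + INR k) * (b + INR k)).
Proof.
  intros Ha Hb; assert (Hk := pos_INR k); unfold wright_coeff.
  rewrite !Rmult_1_r, S_INR, <- !Rplus_assoc, !Gamma_succ by lra.
  assert (H1 := Gamma_pos (a + INR k) ltac:(lra)).
  assert (H2 := Gamma_pos (b + INR k) ltac:(lra)).
  field; lra.
Qed.

Lemma wright_coeff_pos (mu a nu b : R) (k : nat) :
  1 <= mu -> 1 <= a -> 1 <= nu -> 1 <= b -> 0 < wright_coeff mu a nu b k.
Proof.
  intros Hmu Ha Hnu Hb; assert (Hk := pos_INR k).
  assert (0 <= INR k * mu) by (apply Rmult_le_pos; lra).
  assert (0 <= INR k * nu) by (apply Rmult_le_pos; lra).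
  apply Rdiv_lt_0_compat; apply Rmult_lt_0_compat; apply Gamma_pos; lra.
Qed.

(** The index [S k] makes both arguments at least 2, the range where [Gamma_le] applies. *)
Lemma Gamma_shift_le (x m n : R) (k : nat) : 1 <= x -> 1 <= m <= n ->
  Gamma (x + INR (S k) * m) <= Gamma (x + INR (S k) * n).
Proof.
  intros Hx Hmn; rewrite S_INR; assert (Hk := pos_INR k).
  assert (0 <= INR k * m) by (apply Rmult_le_pos; lra).
  assert (0 <= (INR k + 1) * (n - m)) by (apply Rmult_le_pos; lra).
  apply Gamma_le; lra.
Qed.

Lemma wright_coeff_le (mu mu' a nu nu' b : R) (k : nat) :
  1 <= a -> 1 <= b -> 1 <= mu <= mu' -> 1 <= nu <= nu' ->
  wright_coeff mu' a nu' b (S k) <= wright_coeff mu a nu b (S k).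
Proof.
  intros Ha Hb Hmu Hnu; unfold wright_coeff, Rdiv; assert (Hk := pos_INR (S k)).
  assert (0 <= INR (S k) * mu) by (apply Rmult_le_pos; lra).
  assert (0 <= INR (S k) * nu) by (apply Rmult_le_pos; lra).
  assert (H1 := Gamma_pos (a + INR (S k) * mu) ltac:(lra)).
  assert (H2 := Gamma_pos (b + INR (S k) * nu) ltac:(lra)).
  apply Rmult_le_compat_l.
  - left; apply Rmult_lt_0_compat; now apply Gamma_pos.
  - apply Rinv_le_contravar; [now apply Rmult_lt_0_compat |].
    apply Rmult_le_compat; try lra; now apply Gamma_shift_le.
Qed.

Lemma le_geometric (u : nat -> R) (r : R) : 0 <= r ->
  (forall k, u (S k) <= r * u k) -> forall k, u k <= u 0%nat * r ^ k.
Proof.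
  intros Hr Hu; induction k as [| k IH]; [simpl; lra |].
  apply Rle_trans with (1 := Hu k).
  replace (u 0%nat * r ^ S k) with (r * (u 0%nat * r ^ k)) by (simpl; ring).
  now apply Rmult_le_compat_l.
Qed.

Lemma ex_series_ratio (u : nat -> R) (r : R) : 0 <= r < 1 ->
  (forall k, 0 <= u k) -> (forall k, u (S k) <= r * u k) ->
  ex_series u /\ Series u <= u 0%nat * / (1 - r).
Proof.
  intros Hr Hp Hu.
  assert (Hle := le_geometric u r (proj1 Hr) Hu).
  assert (Habs : Rabs r < 1) by (rewrite Rabs_pos_eq; lra).
  assert (Hg : ex_series (fun k => u 0%nat * r ^ k))
    by now apply (ex_series_scal_l (u 0%nat) (fun k => r ^ k)), ex_series_geom.
  split.
  - revert Hg; apply (ex_series_le (V := R_CompleteNormedModule)); intros k.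
    apply Rle_trans with (u k); [right; now apply Rabs_pos_eq | apply Hle].
  - rewrite <- Series_geom, <- Series_scal_l by assumption.
    apply Series_le; [split; auto | assumption].
Qed.

(* The terms [n d_(n-1)] with [n >= 3] decay at least by the factor 1/9, so their sum
   with [2 d_1] is at most [2/(ab) + (9/8) * 3/(a(a+1)b(b+1))]. *)
Lemma starlike_wright_coeffs (a b : R) :
  1 <= a -> 1 <= b -> b >= (3 * a + 2) / (a * (a + 1)) ->
  starlike_coeffs (fun k => wright_coeff 1 a 1 b (S k)).
Proof.
  intros Ha Hb Hab.
  assert (Hab1 : 3 * a + 2 <= b * (a * (a + 1))).
  { apply Rge_le, (Rmult_le_compat_r (a * (a + 1))) in Hab; [| nra].
    replace ((3 * a + 2) / (a * (a + 1)) * (a * (a + 1))) with (3 * a + 2) in Hab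
      by (field; nra); assumption. }
  (* As a >= 1, 3 a + 2 >= 5/2 (a + 1). Then (a + b)^2 >= 4 a b >= 10 gives a + b >= 3, and (a + 2)
     (b + 2) >= 5/2 + 6 + 4 exceeds the 12 of [Hprod]. *)
  assert (Hab2 : 5 / 2 <= a * b).
  { assert (5 / 2 * (a + 1) <= a * b * (a + 1)) by lra; nra. }
  assert (Hab3 : 3 <= a + b) by nra.
  set (d := wright_coeff 1 a 1 b).
  assert (Hd : forall k, 0 < d k) by (intros k; apply wright_coeff_pos; lra).
  assert (HdS : forall k, d (S k) * ((a + INR k) * (b + INR k)) = d k).
  { intros k; unfold d; rewrite wright_coeff_succ by lra.
    assert (Hk := pos_INR k); field; lra. }
  assert (Hprod : forall k, 12 <= (a + INR (S (S k))) * (b + INR (S (S k)))).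
  { intros k; assert (Hk := pos_INR k); rewrite !S_INR; nra. }
  assert (Hdecay : forall k, 12 * d (S (S (S k))) <= d (S (S k))).
  { intros k; rewrite <- (HdS (S (S k))), Rmult_comm.
    apply Rmult_le_compat_l; [left; apply Hd | apply Hprod]. }
  (* For n >= 3, (n + 1) / n <= 4/3, and 4/3 divided by 12 is 1/9. *)
  destruct (ex_series_ratio (fun k => INR (S (S (S k))) * d (S (S k))) (1 / 9))
    as [Hex Hsum]; [lra | | |].
  - intros k; apply Rmult_le_pos; [apply pos_INR | left; apply Hd].
  - intros k; assert (H1 := Hdecay k); assert (H2 := Hd (S (S (S k)))).
    assert (Hk := pos_INR k); rewrite !S_INR; set (x := INR k) in *.
    assert (Hx : 9 * (x + 1 + 1 + 1 + 1) <= 12 * (x + 1 + 1 + 1)) by lra.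
    apply (Rmult_le_compat_r (d (S (S (S k))))) in Hx; [| lra].
    apply (Rmult_le_compat_l (x + 1 + 1 + 1)) in H1; lra.
  - destruct (ex_series_ratio (fun k => INR (S (S (S k))) ^ 2 * d (S (S k))) (1 / 2))
      as [Hex2 _]; [lra | | |].
    + intros k; apply Rmult_le_pos; [apply pow2_ge_0 | left; apply Hd].
    + intros k; assert (H1 := Hdecay k); assert (H2 := Hd (S (S (S k)))).
      assert (Hk := pos_INR k); rewrite !S_INR.
      set (x := INR k) in *.
      assert (Hx : (x + 1 + 1 + 1 + 1) ^ 2 <= 6 * (x + 1 + 1 + 1) ^ 2) by nra.
      apply (Rmult_le_compat_r (d (S (S (S k))))) in Hx; [| lra].
      apply (Rmult_le_compat_l ((x + 1 + 1 + 1) ^ 2)) in H1; [| apply pow2_ge_0].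
      lra.
    + split; [intros k; left; apply Hd | split].
      * apply ex_series_incr_1; exact Hex2.
      * assert (Hex1 : ex_series (fun k => INR (S (S k)) * d (S k)))
          by (apply ex_series_incr_1; exact Hex).
        fold d; rewrite Series_incr_1 by exact Hex1.
        apply Rle_lt_trans with (1 := Rplus_le_compat_l _ _ _ Hsum).
        assert (Hd0 : d 0%nat = 1) by (apply wright_coeff_0; assumption).
        assert (Hd1 := HdS 0%nat); assert (Hd2 := HdS 1%nat); rewrite Hd0 in Hd1.
        simpl INR in Hd1, Hd2; rewrite !Rplus_0_r in Hd1.
        assert (HD : 0 < d 2%nat) by apply Hd.
        set (Y := (a + 1) * (b + 1)) in *.
        (* Since d 1 = Y d 2 and 1 = a b Y d 2, this is the goal 2 d 1 + (9/8) 3 d 2 < 1 divided by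
           d 2. The hypothesis on [b], multiplied by b + 1, gives a b Y - 2 Y >= a (b + 1) >= 7/2 >
           27/8. *)
        assert (Hkey : 2 * Y + 27 / 8 < a * b * Y).
        { assert (Hgap : 0 <= a * b * (a + 1) - 2 * (a + 1) - a) by lra.
          assert (0 <= (a * b * (a + 1) - 2 * (a + 1) - a) * (b + 1))
            by (apply Rmult_le_pos; lra).
          unfold Y; lra. }
        apply (Rmult_lt_compat_r (d 2%nat)) in Hkey; [| assumption].
        replace (/ (1 - 1 / 9)) with (9 / 8) by field.
        simpl INR; rewrite <- Hd2 in Hd1; rewrite <- Hd2; lra.
Qed.

Lemma Wright_id_plus_tail (mu a nu b : R) (z : C) : 1 <= a -> 1 <= b ->
  starlike_coeffs (fun k => wright_coeff mu a nu b (S k)) -> Cmod z <= 1 ->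
  Wright mu a nu b z = (z + tail_series (fun k => wright_coeff mu a nu b (S k)) z)%C.
Proof.
  intros Ha Hb Hc Hz; unfold Wright.
  rewrite CSeries_incr_1.
  - fold (wright_coeff mu a nu b 0); rewrite wright_coeff_0 by assumption.
    f_equal; simpl; ring.
  - apply ex_series_incr_1; exact (ex_series_tail _ _ Hc Hz).
Qed.

Theorem theorem4p1 (a b mu nu : R)
  (ha : 1 <= a) (hb : 1 <= b) (hmu : 1 <= mu) (hnu : 1 <= nu)
  (hab : b >= (3 * a + 2) / (a * (a + 1))) :
  starlike (Wright mu a nu b) /\
  close_to_convex_wrt (Wright mu a nu b) (Wright mu a 1 b).
Proof.
  (* At n = 1 this compares the two functions of part (ii): it transfers [starlike_coeffs] from the
     second to the first and supplies the domination a_k <= b_k. *)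
  assert (Hcd : forall n, 1 <= n <= nu -> forall k,
            0 <= wright_coeff mu a nu b (S k) <= wright_coeff mu a n b (S k)).
  { intros n Hn k; split; [left; apply wright_coeff_pos | apply wright_coeff_le]; lra. }
  assert (Hg : starlike_coeffs (fun k => wright_coeff mu a 1 b (S k))).
  { apply (starlike_coeffs_le _ (fun k => wright_coeff 1 a 1 b (S k)));
      [| now apply starlike_wright_coeffs].
    intros k; split; [left; apply wright_coeff_pos | apply wright_coeff_le]; lra. }
  assert (Hf : starlike_coeffs (fun k => wright_coeff mu a nu b (S k)))
    by (apply (starlike_coeffs_le _ _ (Hcd 1 ltac:(lra)) Hg)).
  split.
  - apply (starlike_id_plus_tail _ _ Hf); intros w; now apply Wright_id_plus_tail.
  - apply (close_to_convex_id_plus_tail _ _ _ _ Hg (Hcd 1 ltac:(lra)));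
      intros w; now apply Wright_id_plus_tail.
Qed.
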